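(* A Borel subset $B\subseteq\mathbb{Z}^\omega$ is Haar null if and only if there exists a sequence of positive integers $(a(n))_{n\in\omega}$ such that $\mu_a(B+x)=0$ for every $x\in\mathbb{Z}^\omega$.
   Context: $\mathbb{Z}^\omega$ is the group of integer sequences under coordinatewise addition with the product of discrete topologies. If $G$ is a Polish group, a set $A\subseteq G$ is called Haar null if there exist a Borel set $B\supseteq A$ and a Borel probability measure $\mu$ on $G$ such that $\mu(gBh)=0$ for every $g,h\in G$. For a positive integer $k$, $\varrho_k$ is the uniform probability measure on $\llbracket 0,k\rrbracket=[0,k]\cap\mathbb{Z}$, i.e. the measure on $\mathbb{Z}$ given by $\varrho_k(X)=\frac{|X\cap\llbracket 0,k\rrbracket|}{k+1}$. For a sequence $(a(n))_{n\in\omega}$ of positive integers, $\mu_a$ is the product Borel probability measure $\bigotimes_{n\in\omega}\varrho_{a(n)}$ on $\mathbb{Z}^\omega$. *)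

(* Defs.v *)
From HB Require Import structures.
From mathcomp Require Import all_boot all_order all_algebra.
From mathcomp Require Import all_classical all_reals all_analysis.
Set Implicit Arguments. Unset Strict Implicit. Unset Printing Implicit Defensive.
Import Order.TTheory GRing.Theory Num.Theory.
Local Open Scope classical_set_scope.
Local Open Scope ring_scope.

(* int pointed by 0 (needed for the generated sigma-algebra type) *)
HB.instance Definition _ := isPointed.Build int 0%R.

Definition Zomega : Type := prod_topology (fun _ : nat => discrete_topology int).

Definition ZomegaB : Type := g_sigma_algebraType (@open Zomega).

Definition zadd (x y : ZomegaB) : ZomegaB := fun n => (x n + y n)%R.

Definition ztranslate (g : ZomegaB) (B : set ZomegaB) (h : ZomegaB) : set ZomegaB :=
  [set zadd (zadd g y) h | y in B].

Definition zshift (B : set ZomegaB) (x : ZomegaB) : set ZomegaB :=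
  [set zadd y x | y in B].

Definition haar_null (R : realType) (A : set ZomegaB) : Prop :=
  exists B : set ZomegaB, measurable B /\ A `<=` B /\
    exists mu : probability ZomegaB R,
      forall g h : ZomegaB, mu (ztranslate g B h) = 0%E.

Definition rho (R : realType) (k : nat) (X : set int) : R :=
  (\sum_(j < k.+1) (if (j%:Z \in X) then 1 else 0)) / (k.+1)%:R.

(* mu is the product measure mu_a = ⊗_n rho_{a(n)}: it is the (unique) Borel
   probability measure whose value on every cylinder
   { x | x_i ∈ A_i for i < n } is  ∏_{i<n} rho_{a(i)}(A_i). *)
Definition is_mu_a (R : realType) (mu : probability ZomegaB R) (a : nat -> nat) : Prop :=
  forall (n : nat) (A : nat -> set int),
    mu [set x : ZomegaB | forall i : nat, (i < n)%N -> A i (x i)] =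
      (\prod_(i < n) rho R (a i) (A i))%:E.

(* Main.v *)
Require Import Defs.
From HB Require Import structures.
From mathcomp Require Import all_boot all_order all_algebra.
From mathcomp Require Import all_classical all_reals all_analysis.
From mathcomp Require Import measurable_realfun.
From mathcomp Require Import zify ring lra.
Set Implicit Arguments. Unset Strict Implicit. Unset Printing Implicit Defensive.
Import Order.TTheory GRing.Theory Num.Theory.
Local Open Scope classical_set_scope.
Local Open Scope ring_scope.

(* Let nu witness that B is Haar null. By tightness some box
   K = {y | |y_i| <= c_i for all i} has positive nu-measure; take a_i so much
   larger than c_i that the sum of 2 c_i / (a_i + 1) converges. By Borel-Cantelli,
   mu_a-almost every x satisfies c_i <= x_i <= a_i - c_i for all but finitely many
   i, so almost all of Z^omega is covered by the countably many boxes F_s that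
   prescribe the initial segment s of x and impose these inequalities afterwards.
   After one translation by a finitely supported u, translating F_s by any y in K
   stays inside the support of mu_a, hence preserves mu_a: a translate A of B
   satisfies mu_a (A `&` F_s) <= mu_a {z | z + u + y in A} for every y in K.
   Integrating over y against nu, Tonelli makes the right-hand side vanish. *)

(** * Cylinders, boxes and the Borel structure of Z^omega *)

(** The filter generated by the cylinders around x converges to x coordinatewise, hence in the
    product topology, so each open neighbourhood of x contains a cylinder. *)
Lemma open_cylinder (U : set Zomega) (x : Zomega) : open U -> U x ->
  exists N, forall y : Zomega, (forall i, (i < N)%N -> y i = x i) -> U y.
Proof.
move=> oU Ux.
pose cyl N : set Zomega := [set y | forall i, (i < N)%N -> y i = x i].
pose F : set_system (prod_topology (fun _ : nat => discrete_topology int)) :=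
  filter_from setT cyl.
have FF : Filter F.
  apply: filter_from_filter; first by exists 0%N.
  move=> m n _ _; exists (maxn m n) => // y ymn.
  by split=> i ilt; apply: ymn; rewrite leq_max ilt ?orbT.
have cF : {ptws, F --> x}.
  apply/pointwise_cvgP => t A /nbhs_singleton At.
  by exists t.+1 => // y yx /=; rewrite yx.
have [N _ NU] := cF U (open_nbhs_nbhs (conj oU Ux)).
by exists N => y /NU.
Qed.

(** Finite sequences of integers are countable, so this makes every open set a countable union of
    cylinders, which reduces Borel measurability to conditions on coordinates. *)
Lemma open_bigcup_cylinder (U : set Zomega) : open U ->
  U = \bigcup_(s in [set s : seq int |
        forall y : Zomega, (forall i, (i < size s)%N -> y i = nth 0 s i) -> U y])
      [set y | forall i, (i < size s)%N -> y i = nth 0 s i].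
Proof.
move=> oU; apply/seteqP; split=> [x Ux | x [s sU xs]]; last exact: sU.
have [N NU] := open_cylinder oU Ux.
exists (mkseq x N) => [y | i]; rewrite size_mkseq.
  by move=> yx; apply: NU => i iN; rewrite yx // nth_mkseq.
by move=> iN; rewrite nth_mkseq.
Qed.

Lemma measurable_bigcup_seq d (T : measurableType d) (S : set (seq int))
  (F : seq int -> set T) : (forall s, measurable (F s)) ->
  measurable (\bigcup_(s in S) F s).
Proof.
move=> mF; rewrite bigcup_mkcond.
apply: countable_bigcupT_measurable => [|s]; first exact: countableP.
by case: ifP.
Qed.

Lemma measurable_preimageT d d' (T : measurableType d) (U : measurableType d')
  (f : T -> U) (C : set U) : measurable_fun setT f -> measurable C ->
  measurable [set w | C (f w)].
Proof. by move=> mf mC; have := mf measurableT _ mC; rewrite setTI. Qed.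

(** The preimage of a cylinder is a countable intersection of coordinate conditions, and open sets
    are countable unions of cylinders. *)
Lemma measurable_to_ZomegaB d (T : measurableType d) (f : T -> ZomegaB) :
  (forall n k, measurable [set w | f w n = k]) -> measurable_fun setT f.
Proof.
move=> mf; apply: (@measurability _ _ T ZomegaB setT f
  (@open Zomega : set (set ZomegaB))) => //.
move=> _ [U oU <-]; rewrite setTI (open_bigcup_cylinder oU) preimage_bigcup.
apply: measurable_bigcup_seq => s.
rewrite (_ : _ @^-1` _ = \bigcap_i
  (if (i < size s)%N then [set w | f w i = nth 0 s i] else setT)).
  by apply: bigcapT_measurable => i; case: ifP.
apply/seteqP; split=> [w ws i _|w ws i si]; first by case: ifP => // /ws.
by have := ws i I; rewrite si.
Qed.

Lemma measurable_coord (n : nat) (X : set int) :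
  measurable [set x : ZomegaB | X (x n)].
Proof.
apply: sub_sigma_algebra.
have cn : continuous (@proj nat (fun _ => discrete_topology int) n : Zomega -> _).
  exact: proj_continuous.
by apply: (proj1 (continuousP _) cn); exact: discrete_open.
Qed.

Lemma measurable_prod_sets (J : nat -> set int) :
  measurable [set x : ZomegaB | forall i, J i (x i)].
Proof.
rewrite (_ : [set _ | _] = \bigcap_i [set x : ZomegaB | J i (x i)]).
  by apply: bigcapT_measurable => i; exact: measurable_coord.
by apply/seteqP; split=> [x xJ i _|x xJ i]; apply: xJ.
Qed.

Lemma measurable_zadd d (T : measurableType d) (f g : T -> ZomegaB) :
  measurable_fun setT f -> measurable_fun setT g ->
  measurable_fun setT (fun w => zadd (f w) (g w)).
Proof.
move=> mf mg; apply: measurable_to_ZomegaB => n k.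
rewrite (_ : [set _ | _] = \bigcup_j
  ([set w | f w n = j] `&` [set w | g w n = k - j])).
  apply: countable_bigcupT_measurable => [|j]; first exact: countableP.
  by apply: measurableI; [move: mf|move: mg] => /measurable_preimageT mh;
    exact: (mh _ (measurable_coord n [set _])).
apply/seteqP; split=> w /=.
  by move=> <-; exists (f w n) => //; split=> //=; rewrite /zadd addrC addKr.
by move=> [j _ [/= fj gj]]; rewrite /zadd fj gj addrC subrK.
Qed.

Definition zbox (n : nat) (A : nat -> set int) : set ZomegaB :=
  [set x : ZomegaB | forall i : nat, (i < n)%N -> A i (x i)].

(** The pi-system on which [is_mu_a] prescribes the measure. *)
Definition zboxes : set (set ZomegaB) :=
  [set C | exists n A, C = zbox n A].

Lemma zboxE n A :
  zbox n A = [set x : ZomegaB | forall i, (if (i < n)%N then A i else setT) (x i)].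
Proof.
apply/seteqP; split=> x xA i; first by case: ifP => // /xA.
by move=> ni; have := xA i; rewrite ni.
Qed.

Lemma measurable_zbox n A : measurable (zbox n A).
Proof.
by rewrite zboxE; exact: (measurable_prod_sets (fun i => if _ then _ else _)).
Qed.

Lemma zboxes_setI_closed : setI_closed zboxes.
Proof.
move=> _ _ [n [A ->]] [m [B ->]]; exists (maxn n m).
exists (fun i => (if (i < n)%N then A i else setT) `&`
                 (if (i < m)%N then B i else setT)).
rewrite !zboxE; apply/seteqP; split=> [x [xA xB] i|x xAB].
  by case: ifP => // _; split; [exact: xA | exact: xB].
by split=> i; have /= := xAB i; rewrite leq_max;
  case: (ltnP i n); case: (ltnP i m) => //= _ _ [].
Qed.

Lemma measurable_zboxes : measurable = <<s zboxes >> :> set (set ZomegaB).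
Proof.
apply/seteqP; split; last first.
  apply: (@smallest_sub _ (sigma_algebra setT) zboxes) => [|_ [n [A ->]]];
    last exact: measurable_zbox.
  split=> [|A mA|F mF]; first exact: measurable0.
    by rewrite setTD; exact: measurableC.
  exact: bigcupT_measurable.
(* For the harder inclusion, the identity from the sigma-algebra generated by boxes to the Borel one
   is measurable by the coordinate criterion. *)
have : measurable_fun setT (idfun : g_sigma_algebraType zboxes -> ZomegaB).
  apply: measurable_to_ZomegaB => n k; apply: sub_sigma_algebra.
  exists n.+1, (fun i => if (i == n)%N then [set k] else setT).
  apply/seteqP; split=> x /=.
    by move=> xk i _; case: eqP => [->|].
  by move=> /(_ n (ltnSn n)); rewrite eqxx.
by move=> mid A mA; have := mid measurableT _ mA; rewrite setTI.
Qed.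

(** * Integer parts and mixed-radix arithmetic *)

Lemma floor_divz (R : realType) (x : R) (q : nat) : (0 < q)%N ->
  Num.floor x = (Num.floor (x * q%:R) %/ q%:Z)%Z.
Proof.
move=> q0; apply: floor_def.
set m := Num.floor (x * q%:R).
have /andP[m1 m2] := floor_itv (x * q%:R); rewrite -/m in m1 m2.
have q0R : 0 < q%:R :> R by rewrite ltr0n.
have /andP[d1 d2] : ((m %/ q%:Z)%Z * q%:Z <= m) &&
    (m + 1 <= ((m %/ q%:Z)%Z + 1) * q%:Z).
  by apply/andP; split; nia.
apply/andP; split.
  rewrite -(ler_pM2r q0R) (le_trans _ m1) //.
  by rewrite -[q%:R]/(q%:Z%:~R) -intrM ler_int.
rewrite -(ltr_pM2r q0R) (lt_le_trans m2) //.
by rewrite -[q%:R]/(q%:Z%:~R) -intrM ler_int.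
Qed.

Lemma big_nat_divmod (R : nmodType) (p q : nat) (F : nat -> R) :
  \sum_(0 <= m < p * q) F m = \sum_(0 <= i < p) \sum_(0 <= j < q) F (i * q + j)%N.
Proof.
elim: p => [|p IH]; first by rewrite mul0n !big_geq.
rewrite big_nat_recr //= -IH mulSnr (big_cat_nat (n := (p * q)%N)) ?leq_addr //=.
congr (_ + _); rewrite -{1}(add0n (p * q)%N) big_addn addKn.
by apply: eq_bigr => j _; rewrite addnC.
Qed.

Lemma rhoE (R : realType) k X :
  rho R k X = (\sum_(0 <= j < k.+1) (j%:Z \in X)%:R) / k.+1%:R.
Proof. by rewrite /rho big_mkord; congr (_ / _); apply: eq_bigr => j _; case: ifP. Qed.

(** Division by q + 1 is a bijection from {0, ..., (p + 1)(q + 1) - 1} onto {0, ..., p} x {0, ...,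
    q}: quotient and remainder of a uniform integer are independent and uniform. *)
Lemma rho_divmod (R : realType) (p q : nat) (X Y : set int) :
  rho R (p.+1 * q.+1).-1 [set m | X (m %/ q.+1%:Z)%Z /\ Y (m %% q.+1%:Z)%Z] =
  rho R p X * rho R q Y.
Proof.
rewrite !rhoE prednK ?muln_gt0 // big_nat_divmod natrM invfM mulrACA.
congr (_ * _); rewrite big_distrlr /=; apply: eq_big_nat => i _.
apply: eq_big_nat => j /andP[_ jq]; rewrite -natrM mulnb.
congr (_%:R); congr nat_of_bool.
have dE : ((i * q.+1 + j)%N%:Z %/ q.+1%:Z)%Z = i.
  by rewrite PoszD PoszM divzMDl // divz_small ?addr0 //; lia.
have mE : ((i * q.+1 + j)%N%:Z %% q.+1%:Z)%Z = j.
  by rewrite PoszD PoszM modzMDl modz_small //; lia.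
by apply/idP/andP; rewrite !inE /= dE mE => -[].
Qed.

(** * The uniform distribution on [0, 1[ *)

Section uniform01.
Variable R : realType.

Lemma measurable_itvco01 : measurable (`[0, 1[%classic : set R).
Proof. exact: measurable_itv. Qed.

Definition uniform01 := mrestr (@lebesgue_measure R) measurable_itvco01.

HB.instance Definition _ := Measure.on uniform01.

Lemma uniform01_setT : uniform01 setT = 1%E.
Proof.
rewrite /uniform01 /mrestr setTI lebesgue_measure_itv /= lte_fin ltr01.
by rewrite oppr0 adde0.
Qed.

HB.instance Definition _ :=
  Measure_isProbability.Build _ _ R uniform01 uniform01_setT.

Lemma floor_preimage (P : R) (m : int) : 0 < P ->
  [set x : R | Num.floor (x * P) = m] = `[m%:~R / P, (m + 1)%:~R / P[%classic.
Proof.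
move=> P0; apply/seteqP; split=> x /=; rewrite in_itv /=.
  by move=> <-; rewrite ler_pdivrMr // ltr_pdivlMr // floor_itv.
by rewrite ler_pdivrMr // ltr_pdivlMr // => /floor_def.
Qed.

Lemma measurable_floor_preimage (P : R) (X : set int) : 0 < P ->
  measurable [set x : R | X (Num.floor (x * P))].
Proof.
move=> P0.
rewrite (_ : [set _ | _] = \bigcup_m
  (if m \in X then [set x : R | Num.floor (x * P) = m] else set0)).
  apply: countable_bigcupT_measurable => [|m]; first exact: countableP.
  by case: ifP => // _; rewrite floor_preimage //; exact: measurable_itv.
apply/seteqP; split=> x /=.
  by move=> Xx; exists (Num.floor (x * P)) => //; rewrite mem_set.
by move=> [m _]; case: ifP => // /set_mem Xm /= ->.
Qed.

(** The points of [0, 1[ with a given integer part j of x (p + 1) form an interval of length 1 / (p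
    + 1), for each j from 0 to p. *)
Lemma uniform01_floor (p : nat) (X : set int) :
  uniform01 [set x | X (Num.floor (x * p.+1%:R))] = (rho R p X)%:E.
Proof.
set P : R := p.+1%:R; have P0 : 0 < P by rewrite ltr0n.
pose F (j : nat) : set R :=
  if j%:Z \in X then `[j%:R / P, j.+1%:R / P[%classic else set0.
have FE j : F j = [set x | Num.floor (x * P) = j%:Z /\ X j%:Z].
  rewrite /F; case: ifP => jX.
    rewrite -[j%:R]/(j%:Z%:~R) -addn1 -[(j + 1)%:R]/((j%:Z + 1)%:~R) -floor_preimage //.
    by apply/seteqP; split=> x /=; [move=> ->; split=> //; exact: set_mem|case].
  by apply/seteqP; split=> x //= -[_ /mem_set]; rewrite jX.
have -> : uniform01 [set x | X (Num.floor (x * P))] =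
    lebesgue_measure (\big[setU/set0]_(j < p.+1) F j).
  rewrite /uniform01 /mrestr; congr (lebesgue_measure _).
  rewrite -bigcup_mkord; apply/seteqP; split=> x /=.
    rewrite in_itv /= => -[Xx /andP[x0 x1]].
    have f0 : 0 <= Num.floor (x * P) by rewrite floor_ge0 mulr_ge0 // ltW.
    exists `|Num.floor (x * P)|%N => /=.
      rewrite -ltz_nat gez0_abs // floor_lt_int -[_%:~R]/P.
      by rewrite -{2}[P]mul1r ltr_pM2r.
    by rewrite FE /= gez0_abs.
  move=> [j /= jp]; rewrite FE /= => -[fj Xj].
  rewrite fj; split=> //; rewrite in_itv /=.
  have : Num.floor (x * P) == j%:Z by apply/eqP.
  rewrite floor_eq => /andP[j1 j2]; apply/andP; split.
    by rewrite -(pmulr_lge0 _ P0) (le_trans _ j1) // ler0n.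
  rewrite -(ltr_pM2r P0) mul1r (lt_le_trans j2) //.
  by rewrite -[P]/(p.+1%:Z%:~R) ler_int; lia.
rewrite measure_bigsetU; last 2 first.
- by move=> j; rewrite /F; case: ifP => // _; exact: measurable_itv.
- by move=> i j _ _ [x []]; rewrite !FE /= => -[-> _] [[]].
rewrite rhoE big_mkord mulr_suml -sumEFin; apply: eq_bigr => j _.
rewrite /F; case: ifP => jX; last by rewrite measure0 mul0r.
have -> : 1 / P = j.+1%:R / P - j%:R / P by rewrite -mulrBl -natrB // subSnn.
etransitivity; first exact: (lebesgue_measure_itv `[j%:R / P, j.+1%:R / P[).
rewrite /= lte_fin ltr_pM2r ?invr_gt0 // ltr_nat ltnSn.
by rewrite -EFinD.
Qed.

End uniform01.

(** * Construction of mu_a as the law of random digits *)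

Section mu_a_existence.
Variables (R : realType) (a : nat -> nat).

Definition radix_prod (n : nat) : nat := (\prod_(i < n) (a i).+1)%N.

(* The Cantor series (mixed-radix) digits of x: for x uniform in [0, 1[ they are
   independent, the n-th one being uniform in {0, ..., a n}. *)
Definition digits (x : measurableTypeR R) : ZomegaB :=
  fun n => (Num.floor ((x : R) * (radix_prod n.+1)%:R) %% (a n).+1%:Z)%Z.

(* The values of floor (x * radix_prod n) for which the first n digits of x lie in
   A 0, ..., A (n - 1). *)
Fixpoint digits_target (A : nat -> set int) (n : nat) : set int :=
  if n is k.+1 then
    [set m | digits_target A k (m %/ (a k).+1%:Z)%Z /\ A k (m %% (a k).+1%:Z)%Z]
  else setT.

Lemma radix_prod_gt0 n : (0 < radix_prod n)%N.
Proof. by rewrite prodn_gt0. Qed.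

(** The single integer floor (x * radix_prod n) determines the first n digits; dividing it by the
    last radix drops the last digit. *)
Lemma digits_preimage_zbox A n :
  [set x | zbox n A (digits x)] =
  [set x | digits_target A n (Num.floor (x * (radix_prod n)%:R))].
Proof.
elim: n => [|n IH]; first by apply/seteqP; split.
have fl (x : R) : (Num.floor (x * (radix_prod n.+1)%:R) %/ (a n).+1%:Z)%Z =
    Num.floor (x * (radix_prod n)%:R).
  by rewrite {1}/radix_prod big_ord_recr /= natrM mulrA -floor_divz.
have IHx x : zbox n A (digits x) =
    digits_target A n (Num.floor (x * (radix_prod n)%:R)).
  exact: (congr1 (fun S : set R => S x) IH).
apply/seteqP; split=> x /=; rewrite fl -IHx.
  by move=> xA; split=> [i ni|]; apply: xA => //; rewrite ltnS ltnW.
by move=> [xA xn] i; rewrite ltnS leq_eqVlt => /predU1P[->|/xA].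
Qed.

Lemma measurable_digits : measurable_fun setT digits.
Proof.
apply: measurable_to_ZomegaB => n k.
apply: (@measurable_floor_preimage R _ [set m | (m %% (a n).+1%:Z)%Z = k]).
by rewrite ltr0n radix_prod_gt0.
Qed.

HB.instance Definition _ :=
  isMeasurableFun.Build _ _ _ _ digits measurable_digits.

Definition digits_distribution : probability ZomegaB R :=
  distribution (@uniform01 R) (digits : {mfun measurableTypeR R >-> ZomegaB}).

Lemma is_mu_a_digits : is_mu_a digits_distribution a.
Proof.
move=> n A.
transitivity (@uniform01 R [set x | digits_target A n
    (Num.floor (x * (radix_prod n)%:R))]).
  by congr uniform01; exact: digits_preimage_zbox.
(* This integer is uniform below [radix_prod n]; [rho_divmod] then splits off one digit at a
   time. *)
rewrite -(prednK (radix_prod_gt0 n)) uniform01_floor; congr (_%:E).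
elim: n => [|n IH].
  by rewrite /radix_prod !big_ord0 /rho big_ord1 /= in_setT divr1.
rewrite big_ord_recr /= -IH {1}/radix_prod big_ord_recr /= -/(radix_prod n).
by rewrite -{1}(prednK (radix_prod_gt0 n)) rho_divmod.
Qed.

End mu_a_existence.

Lemma mu_a_exists (R : realType) (a : nat -> nat) :
  exists mu : probability ZomegaB R, is_mu_a mu a.
Proof. by exists (digits_distribution R a); exact: is_mu_a_digits. Qed.

(** * Products and translations under mu_a *)

(** Both X and X - s lie in {0, ..., k}, so [rho] only compares their cardinalities. The double sum
    over pairs i = j + s matches their elements. *)
Lemma rho_shift (R : realType) (k : nat) (X : set int) (s : int) :
  (forall m, X m -> 0 <= m <= k%:Z) ->
  (forall m, X (m + s) -> 0 <= m <= k%:Z) ->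
  rho R k X = rho R k [set m | X (m + s)].
Proof.
move=> Xk Xsk; rewrite !rhoE !big_mkord; congr (_ / _).
pose P (i j : 'I_k.+1) : R := ((i%:Z \in X) && (i%:Z == j%:Z + s))%:R.
transitivity (\sum_(i < k.+1) \sum_(j < k.+1) P i j).
  apply: eq_bigr => i _; rewrite /P; case: (boolP (_ \in X)) => [/set_mem Xi|_].
    have ik : 0 <= i%:Z - s <= k%:Z by apply: Xsk; rewrite subrK.
    have ilt : (`|i%:Z - s|%N < k.+1)%N by lia.
    rewrite (bigD1 (Ordinal ilt)) //= (_ : _ == _); last by apply/eqP; lia.
    by rewrite big1 ?addr0 // => j /eqP jN; case: eqP => // e;
      case: jN; apply: val_inj => /=; lia.
  by rewrite big1.
rewrite exchange_big /=; apply: eq_bigr => j _; rewrite /P.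
case: (boolP (j%:Z \in _)) => [/set_mem /= Xj|Xj]; last first.
  rewrite big1 // => i _; case: eqP => [->|]; last by rewrite andbF.
  rewrite andbT (_ : _ \in _ = false) //; apply: contraNF Xj => /set_mem Xj.
  exact/mem_set.
have jk := Xk _ Xj; have jlt : (absz (j%:Z + s)%R < k.+1)%N by lia.
rewrite (bigD1 (Ordinal jlt)) //= (_ : (absz _)%:Z = j%:Z + s); last by lia.
rewrite (mem_set Xj) eqxx big1 ?addr0 // => i /eqP iN.
by case: eqP => [e|]; rewrite ?andbF //; case: iN; apply: val_inj => /=; lia.
Qed.

Section mu_a_theory.
Variables (R : realType) (mu : probability ZomegaB R) (a : nat -> nat).
Hypothesis mua : is_mu_a mu a.

(** Continuity from above along the decreasing boxes [zbox n J]. *)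
Lemma mu_a_prod_cvg (J : nat -> set int) :
  (\prod_(i < n) rho R (a i) (J i))%:E @[n --> \oo] -->
  mu [set x : ZomegaB | forall i, J i (x i)].
Proof.
have -> : [set x : ZomegaB | forall i, J i (x i)] = \bigcap_n zbox n J.
  apply/seteqP; split=> [x xJ n _ i _|x xJ i]; first exact: xJ.
  exact: (xJ i.+1 I).
under eq_fun do rewrite -mua.
apply: nonincreasing_cvg_mu => [||| m n mn].
- by rewrite -ge0_fin_numE // fin_num_measure //; exact: measurable_zbox.
- by move=> n; exact: measurable_zbox.
- by apply: bigcapT_measurable => n; exact: measurable_zbox.
- by apply/subsetPset => x xn i im; apply: xn; apply: leq_trans mn.
Qed.

Lemma mu_a_prod_eq (J J' : nat -> set int) :
  (forall i, rho R (a i) (J i) = rho R (a i) (J' i)) ->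
  mu [set x : ZomegaB | forall i, J i (x i)] =
  mu [set x : ZomegaB | forall i, J' i (x i)].
Proof.
move=> JJ'; apply: (cvg_unique _ (mu_a_prod_cvg (J := J))) => //.
rewrite (_ : (fun n => _) = fun n => (\prod_(i < n) rho R (a i) (J' i))%:E).
  exact: mu_a_prod_cvg.
by apply/funext => n; congr (_%:E); apply: eq_bigr => i _; rewrite JJ'.
Qed.

Lemma mu_a_coord (i : nat) (X : set int) :
  mu [set x : ZomegaB | X (x i)] = (rho R (a i) X)%:E.
Proof.
have rhoT k : rho R k setT = 1.
  rewrite /rho (eq_bigr (fun=> 1)) => [|j _]; last by rewrite in_setT.
  by rewrite sumr_const card_ord divff // pnatr_eq0.
have -> : [set x : ZomegaB | X (x i)] = zbox i.+1 (fun j => if j == i then X else setT).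
  apply/seteqP; split=> [x xX j _|x]; first by case: eqP => // ->.
  by move=> /(_ i (ltnSn i)); rewrite eqxx.
rewrite mua big_ord_recr /= eqxx big1 ?mul1r // => j _.
by rewrite ltn_eqF.
Qed.

(* Translation moves no mass across the boundary of the support as long as both
   the product set and its translate stay inside the support. *)
Lemma mu_a_translate (J : nat -> set int) (s : ZomegaB) (C : set ZomegaB) :
  (forall i m, J i m -> 0 <= m <= (a i)%:Z) ->
  (forall i m, J i (m + s i) -> 0 <= m <= (a i)%:Z) ->
  measurable C -> (forall x, C x -> forall i, J i (x i)) ->
  mu C = mu [set z | C (zadd z s)].
Proof.
move=> Ja Jsa mC CJ.
pose E := [set x : ZomegaB | forall i, J i (x i)].
have mE : measurable E := measurable_prod_sets J.
have mf : measurable_fun setT (fun z : ZomegaB => zadd z s).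
  by apply: measurable_zadd => //; exact: measurable_cst.
pose f : {mfun ZomegaB >-> ZomegaB} := mfun_Sub (mem_set mf).
(* Compare mu with its image under translation, both restricted to E. They agree on boxes by
   [rho_shift] in each coordinate, hence on all Borel sets, and C lies in E. *)
pose m1 := mrestr mu mE.
pose m2 := mrestr (distribution mu f) mE.
suff : m1 C = m2 C.
  rewrite /m1 /m2 /mrestr setIidl //.
apply: (measure_unique zboxes (fun=> setT) measurable_zboxes zboxes_setI_closed) => //.
- by move=> _; exists 0%N, (fun=> setT); apply/seteqP; split.
- by rewrite bigcup_const.
- move=> _ [n [A ->]]; rewrite /m1 /m2 /mrestr.
  pose A' i := if (i < n)%N then A i else setT.
  have DE : zbox n A `&` E = [set x : ZomegaB | forall i, (A' i `&` J i) (x i)].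
    rewrite zboxE; apply/seteqP; split=> [x [xA xJ] i|x xAJ].
      by split; [exact: xA|exact: xJ].
    by split=> i; case: (xAJ i).
  change (mu (zbox n A `&` E) = mu [set z | (zbox n A `&` E) (zadd z s)]).
  rewrite DE; apply: (@mu_a_prod_eq (fun i => A' i `&` J i)
    (fun i => [set m | (A' i `&` J i) (m + s i)])) => i.
  by apply: rho_shift => m [_]; [exact: Ja|exact: Jsa].
- move=> _; rewrite /m1 /mrestr -ge0_fin_numE // fin_num_measure //.
Qed.

End mu_a_theory.

(** * Tightness *)

Lemma geometric_eseries_le (R : realType) (e : R) : 0 <= e ->
  (\sum_(0 <= i <oo) (e / (2 ^ i.+1)%:R)%:E <= e%:E)%E.
Proof.
move=> e0; have := @epsilon_trick R (fun=> 0%E) e xpredT (fun=> lexx _) e0.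
rewrite (@eseries0 _ (fun=> 0%E)) //.
by rewrite add0e; under eq_eseriesr do rewrite add0e.
Qed.

(** The sets where |x_i| exceeds c decrease to the empty set as c grows. *)
Lemma tight_coord (R : realType) (mu : probability ZomegaB R) (i : nat) (e : R) :
  0 < e -> exists c : nat, (mu [set x : ZomegaB | ((c%:Z < `|x i|)%R : Prop)] < e%:E)%E.
Proof.
move=> e0; pose F c := [set x : ZomegaB | ((c%:Z < `|x i|)%R : Prop)].
have mF c : measurable (F c).
  exact: (measurable_coord i [set k : int | ((c%:Z < `|k|)%R : Prop)]).
have F0 : \bigcap_c F c = set0.
  by rewrite -subset0 => x /(_ `|x i|%N I); rewrite /F /= abszE ltxx.
have cF : mu (F c) @[c --> \oo] --> 0%E.
  rewrite -(@measure0 _ _ _ mu) -F0; apply: nonincreasing_cvg_mu => //.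
  - by rewrite -ge0_fin_numE // fin_num_measure.
  - by rewrite F0.
  - move=> m n mn; apply/subsetPset => x; rewrite /F /=; apply: le_lt_trans.
    by rewrite lez_nat.
have e_nbhs : nbhs 0%E [set y : \bar R | (y < e%:E)%E].
  by apply: open_ereal_lt'; rewrite lte_fin.
have [N _ NF] := cF _ e_nbhs; exists N; exact: (NF N (leqnn N)).
Qed.

Lemma tight (R : realType) (mu : probability ZomegaB R) :
  exists c : nat -> nat,
    (0 < mu [set x : ZomegaB | forall i, (`|x i| <= (c i)%:Z)%R])%E.
Proof.
(* The tail bounds sum to at most 1/2, so the complement of the box has measure at most 1/2. *)
have e0 i : 0 < 2^-1 / (2 ^ i.+1)%:R :> R by rewrite divr_gt0 // ltr0n expn_gt0.
have [c cP] := choice (fun i => tight_coord mu i (e0 i)).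
exists c; set K := [set x | _].
have mK : measurable K.
  exact: (measurable_prod_sets (fun i =>
    [set k : int | ((`|k| <= (c i)%:Z)%R : Prop)])).
have : (mu (~` K) <= 2^-1%:E)%E.
  apply: le_trans (geometric_eseries_le _); last by [].
  apply: (@le_trans _ _ (\sum_(0 <= i <oo)
      mu [set x : ZomegaB | (((c i)%:Z < `|x i|)%R : Prop)])%E).
    apply: measure_sigma_subadditive => [i||].
    - exact: (measurable_coord i [set k : int | (((c i)%:Z < `|k|)%R : Prop)]).
    - exact: measurableC.
    - by move=> x /existsNP [i /negP]; rewrite -ltNge => xi; exists i.
  by apply: lee_nneseries => [i _ //|i _]; exact/ltW/cP.
rewrite probability_setC // lee_subel_addr // -leeBlDl //.
by apply: lt_le_trans; rewrite -EFinB lte_fin; lra.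
Qed.

(** * The Tonelli argument *)

(** By Tonelli, y |-> mu (A - y) has nu-integral 0. It is at least d on K, so d nu(K) <= 0, which
    forces d = 0 as nu(K) > 0. *)
Lemma null_of_translates (R : realType) (mu nu : probability ZomegaB R)
  (K A : set ZomegaB) (d : \bar R) : measurable K -> measurable A ->
  (0 < nu K)%E -> (0 <= d)%E ->
  (forall z, nu [set y | A (zadd z y)] = 0%E) ->
  (forall y, K y -> (d <= mu [set z | A (zadd z y)])%E) -> d = 0%E.
Proof.
move=> mK mA K0 d0 nu0 dmu.
pose M : set (ZomegaB * ZomegaB) := [set w | A (zadd w.1 w.2)].
have mM : measurable M.
  apply: (measurable_preimageT _ mA).
  by apply: measurable_zadd; [exact: measurable_fst|exact: measurable_snd].
have xM z : xsection M z = [set y | A (zadd z y)].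
  by apply/seteqP; split=> y; rewrite /xsection /= inE.
have yM y : ysection M y = [set z | A (zadd z y)].
  by apply/seteqP; split=> z; rewrite /ysection /= inE.
have int0 : (\int[nu]_y mu [set z | A (zadd z y)] = 0)%E.
  have := indic_fubini_tonelli mu nu mM.
  rewrite (indic_fubini_tonelli_FE _ mM) (indic_fubini_tonelli_GE _ mM).
  rewrite [X in X = _]integral0_eq => [|z _ /=]; last by rewrite xM nu0.
  by move=> /esym <-; apply: eq_integral => y _ /=; rewrite yM.
pose G (y : ZomegaB) : \bar R := mu [set z | A (zadd z y)].
have mG : @measurable_fun _ _ ZomegaB (\bar R) setT G.
  rewrite (_ : G = mu \o ysection M); first exact: measurable_fun_ysection.
  by apply/funext => y /=; rewrite yM.
have : (\int[nu]_(y in K) d <= \int[nu]_y G y)%E.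
  apply: (@le_trans _ _ (\int[nu]_(y in K) G y)%E).
    by apply: ge0_le_integral => //; exact: measurable_funTS.
  by apply: ge0_subset_integral.
rewrite int0 integral_cst // => dK; apply/eqP; rewrite eq_le d0 andbT.
by rewrite leNgt; apply/negP => d_gt0; move: dK; rewrite leNgt mule_gt0.
Qed.

(** * Estimates for [rho] and rewriting of translates *)

Lemma rho_eq0 (R : realType) (k : nat) (X : set int) :
  (forall m, X m -> ~ (0 <= m <= k%:Z)) -> rho R k X = 0.
Proof.
move=> Xk; rewrite /rho big1 ?mul0r // => j _; case: ifP => // /set_mem /Xk.
by case; have := ltn_ord j; lia.
Qed.

Lemma rho_margin_le (R : realType) (k c : nat) : (c.*2 <= k)%N ->
  rho R k [set m | ~ (c%:Z <= m <= k%:Z - c%:Z)] <= c.*2%:R / k.+1%:R.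
Proof.
move=> ck; rewrite rhoE ler_pM2r ?invr_gt0 ?ltr0n //.
rewrite -natr_sum ler_nat.
(* Cut {0, ..., k} into its first c points, its last c points and the middle, which contributes
   nothing. *)
rewrite (@big_cat_nat _ _ _ (k.+1 - c)) //=; last by lia.
rewrite (@big_cat_nat _ _ _ c) //=; last by lia.
rewrite [X in (_ + X + _)%N](_ : _ = 0%N) => [|]; last first.
  rewrite big_nat_cond big1 // => j /andP[jc _].
  by case: (boolP (_ \in _)) => // /set_mem; case; lia.
rewrite -addnn addn0 leq_add //.
  apply: (@leq_trans (\sum_(0 <= j < c) 1)%N);
    first by apply: leq_sum => j _; case: (_ \in _).
  by rewrite sum_nat_const_nat; lia.
apply: (@leq_trans (\sum_(k.+1 - c <= j < k.+1) 1)%N);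
    first by apply: leq_sum => j _; case: (_ \in _).
by rewrite sum_nat_const_nat; lia.
Qed.

Lemma zshiftE (B : set ZomegaB) (x : ZomegaB) :
  zshift B x = [set y | B (zadd y (fun n => - x n))].
Proof.
apply/seteqP; split=> [_ [y By <-]|y By].
  by rewrite /= (_ : zadd _ _ = y) //; apply/funext => n; rewrite /zadd addrK.
exists (zadd y (fun n => - x n)) => //.
by apply/funext => n; rewrite /zadd subrK.
Qed.

Lemma ztranslateE (g h : ZomegaB) (B : set ZomegaB) :
  ztranslate g B h = zshift B (zadd g h).
Proof.
rewrite /ztranslate /zshift; apply: eq_imagel => y _.
by apply/funext => n; rewrite /zadd addrAC addrC.
Qed.

Lemma measurable_zshift (B : set ZomegaB) (x : ZomegaB) :
  measurable B -> measurable (zshift B x).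
Proof.
move=> mB; rewrite zshiftE.
apply: (measurable_preimageT _ mB).
by apply: measurable_zadd => //; exact: measurable_cst.
Qed.

(** * Covering by margin boxes and Borel-Cantelli *)

Definition margin_sets (a c : nat -> nat) (s : seq int) (i : nat) : set int :=
  if (i < size s)%N then [set nth 0 s i]
  else [set m | (c i)%:Z <= m <= (a i)%:Z - (c i)%:Z].

Definition margin_box (a c : nat -> nat) (s : seq int) : set ZomegaB :=
  [set x : ZomegaB | forall i, margin_sets a c s i (x i)].

Section key.
Variables (R : realType) (mu nu : probability ZomegaB R) (a c : nat -> nat).
Hypothesis mua : is_mu_a mu a.
Hypothesis ca : forall i, ((c i).*2 <= a i)%N.

Let K := [set y : ZomegaB | forall i, (`|y i| <= (c i)%:Z)%R].
Hypothesis K0 : (0 < nu K)%E.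

(** [null_of_translates] is applied with d the measure of the part of A in the box, and with A - u
    in place of A; [mu_a_translate] gives the lower bound for y in K. *)
Lemma mu_a_margin_box_null (A : set ZomegaB) (s : seq int) :
  measurable A -> (forall z, nu [set y | A (zadd z y)] = 0%E) ->
  mu (A `&` margin_box a c s) = 0%E.
Proof.
move=> mA nuA.
have mF : measurable (margin_box a c s) := measurable_prod_sets (margin_sets a c s).
have mAF : measurable (A `&` margin_box a c s) by exact: measurableI.
have [sa|/existsNP[i]] := pselect
  (forall i, (i < size s)%N -> 0 <= nth 0 s i <= (a i)%:Z); last first.
  (* If s prescribes a value outside {0, ..., a_i}, the whole margin box is already null. *)
  move=> /not_implyP[si /negP sia]; apply/eqP.
  rewrite -measure_le0 -[leRHS](_ : mu [set x : ZomegaB | x i = nth 0 s i] = 0%E).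
    apply: le_measure; rewrite ?inE //.
      exact: (measurable_coord i [set nth 0 s i]).
    by move=> x [_ /(_ i)]; rewrite /margin_sets si.
  rewrite (mu_a_coord mua i [set nth 0 s i]) rho_eq0 // => m -> /=.
  exact/negP.
(* Translation by - (u + y) moves the prescribed value s_i to c_i - y_i, which
   lies in [0, 2 c_i] and hence in the support of mu_a. *)
pose u : ZomegaB := fun i => if (i < size s)%N then nth 0 s i - (c i)%:Z else 0.
have mw : measurable_fun setT (fun w : ZomegaB => zadd w u).
  by apply: measurable_zadd => //; exact: measurable_cst.
apply: (@null_of_translates _ mu nu K [set w | A (zadd w u)]) => //.
- exact: (measurable_prod_sets (fun i =>
    [set k : int | ((`|k| <= (c i)%:Z)%R : Prop)])).
- exact: measurable_preimageT mw mA.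
- move=> z; rewrite -(nuA (zadd z u)); congr (nu _).
  have zyu y : zadd (zadd z y) u = zadd (zadd z u) y.
    by apply/funext => n; rewrite /zadd addrAC.
  by apply/seteqP; split=> y /=; rewrite zyu.
move=> y yK.
rewrite (@mu_a_translate _ _ _ mua (margin_sets a c s) (zadd y u)) //.
- have mz : measurable_fun setT (fun z : ZomegaB => zadd z (zadd y u)).
    by apply: measurable_zadd => //; exact: measurable_cst.
  have mzu : measurable_fun setT (fun z : ZomegaB => zadd (zadd z y) u).
    apply: measurable_zadd; last exact: measurable_cst.
    by apply: measurable_zadd => //; exact: measurable_cst.
  apply: le_measure; rewrite ?inE.
  + exact: measurable_preimageT mz mAF.
  + exact: measurable_preimageT mzu mA.
  move=> z /= [Az _].
  rewrite (_ : zadd (zadd z y) u = zadd z (zadd y u)) //.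
  by apply/funext => n; rewrite /zadd addrA.
- move=> i m; rewrite /margin_sets; case: ifP => [si ->|_ /=]; first exact: sa.
  by have := ca i; lia.
- move=> i m; rewrite /margin_sets /zadd /u; have := yK i; have := ca i.
  by case: ifP => [si|_] /=; lia.
- by move=> x [].
Qed.

Lemma mu_a_null (A : set ZomegaB) :
  measurable A -> (forall z, nu [set y | A (zadd z y)] = 0%E) ->
  (\sum_(0 <= i <oo) ((c i).*2%:R / (a i).+1%:R)%:E < +oo :> \bar R)%E ->
  mu A = 0%E.
Proof.
move=> mA nuA ac.
pose G i := [set x : ZomegaB | ~ ((c i)%:Z <= x i <= (a i)%:Z - (c i)%:Z)].
have mG i : measurable (G i) :=
  measurable_coord i [set m | ~ ((c i)%:Z <= m <= (a i)%:Z - (c i)%:Z)].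
(* Borel-Cantelli: almost surely only finitely many coordinates violate the margin. *)
have G0 : mu (lim_sup_set G) = 0%E.
  apply: lim_sup_set_cvg0 => //; apply: le_lt_trans ac.
  apply: lee_nneseries => [i _ //|i _].
  have muG : mu (G i) = _ :=
    mu_a_coord mua i [set m | ~ ((c i)%:Z <= m <= (a i)%:Z - (c i)%:Z)].
  suff : (mu (G i) <= ((c i).*2%:R / (a i).+1%:R)%:E)%E by [].
  by rewrite muG lee_fin rho_margin_le.
have mF s : measurable (margin_box a c s) := measurable_prod_sets (margin_sets a c s).
(* Enumerate the finite sequences s by their codes; integers that code no sequence get the empty
   set. *)
pose F n := if unpickle n is Some s then A `&` margin_box a c s else set0.
apply/(negligibleP mu mA).
apply: (@negligibleS _ _ _ mu (lim_sup_set G `|` \bigcup_n F n)) => [x Ax|].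
  case: (pselect (lim_sup_set G x)) => [|nG]; first by left.
  right; have [N NG] : exists N, forall i, (N <= i)%N -> ~ G i x.
    move: nG => /existsNP[N /not_implyP[_ nG]]; exists N => i Ni Gi.
    (* Beyond N all margin inequalities hold, so x lies in the margin box of its own initial segment
       of length N. *)
    by apply: nG; exists i.
  exists (pickle (mkseq x N)) => //; rewrite /F pickleK; split=> // i.
  rewrite /margin_sets size_mkseq; case: ltnP => iN; first by rewrite /= nth_mkseq.
  by have /contrapT := NG i iN.
apply: negligibleU.
  apply/negligibleP => //; apply: bigcapT_measurable => n.
  exact: bigcup_measurable.
apply: negligible_bigcup => n; rewrite /F; case: unpickle => [s|];
  last exact: negligible_set0.
by apply/negligibleP; [exact: measurableI|exact: mu_a_margin_box_null].
Qed.

End key.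

(** * The characterization of Haar null Borel sets *)

Theorem theorem3p1 (R : realType) (B : set ZomegaB) :
  measurable B ->
  (haar_null R B <->
   exists a : nat -> nat, (forall n, (0 < a n)%N) /\
     exists mu : probability ZomegaB R, is_mu_a mu a /\
       forall x : ZomegaB, mu (zshift B x) = 0%E).
Proof.
move=> mB; split; last first.
  (* For the converse, B is its own Borel hull and mu_a the witness: by commutativity g + B + h is B
     + (g + h). *)
  move=> [a [_ [mu [_ muB]]]]; exists B; split=> //; split=> //.
  by exists mu => g h; rewrite ztranslateE.
move=> [B' [mB' [BB' [nu nuB']]]].
have [c K0] := tight nu.
(* This makes 2 c_i / (a_i + 1) at most 2^-(i + 1), so the series is at most 1; the successor keeps
   a_i positive when c_i = 0. *)
pose a i := ((c i).*2.+1 * 2 ^ i.+1)%N.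
have ca i : ((c i).*2 < a i)%N by rewrite /a -addn1 leq_pmulr ?expn_gt0.
have [mu mua] := mu_a_exists R a.
exists a; split=> [n|]; first exact: leq_ltn_trans (ca n).
exists mu; split=> // x.
apply: (@mu_a_null _ mu nu a c) => //.
- by move=> i; exact: ltnW.
- exact: measurable_zshift.
(* The set of y with z + y in B + x is B + (x - z), contained in the nu-null set B' + (x - z). *)
- move=> z; pose g : ZomegaB := fun n => x n - z n.
  have mg (C : set ZomegaB) : measurable C -> measurable (zshift C g).
    exact: measurable_zshift.
  apply/eqP; rewrite -measure_le0 -(nuB' g (fun=> 0)).
  have -> : [set y | zshift B x (zadd z y)] = zshift B g.
    have zyg y : zadd (zadd z y) (fun n => - x n) = zadd y (fun n => - g n).
      apply/funext => n; rewrite /zadd /g; ring.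
    by rewrite !zshiftE; apply/seteqP; split=> y /=; rewrite zyg.
  have -> : ztranslate g B' (fun=> 0) = zshift B' g.
    by rewrite ztranslateE; congr zshift; apply/funext => n; rewrite /zadd addr0.
  by apply: le_measure; rewrite ?inE; [exact: mg|exact: mg|exact: image_subset].
apply: (@le_lt_trans _ _ 1%:E); last exact: ltry.
apply: le_trans (geometric_eseries_le ler01).
apply: lee_nneseries => [i _|i _]; rewrite lee_fin ?divr_ge0 //.
rewrite ler_pdivrMr ?ltr0n // mul1r mulrC ler_pdivlMr ?ltr0n ?expn_gt0 //.
rewrite -natrM ler_nat /a; nia.
Qed.
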